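(* Let $\Gamma$ be a weakly negative definite plumbing graph with invertible linking matrix $B$, let $M$ be the rational homology $3$-sphere obtained from integral surgery on the framed link defined by $\Gamma$, and let $\mathfrak s$ be a $\mathrm{Spin}^c$ structure on $M$. Then there exists a root of unity $c_{\mathfrak s}\in\mathbb C$, whose order divides $8\,|H_1(M;\mathbb Z)|$, such that $$\widehat Z^{\mathfrak{osp}(1|2)}_{\mathfrak s}(M;-\mathbf q)=c_{\mathfrak s}\,\widehat Z^{\mathfrak{sl}(2)}_{\mathfrak s}(M;\mathbf q).$$ Here the substitution $\mathbf q\mapsto-\mathbf q$ in fractional powers is $(-\mathbf q)^x=e^{\pi\sqrt{-1}x}\mathbf q^x$ for $x\in\mathbb Q$.
   Context: A plumbing graph is a finite tree $\Gamma$ with vertex set $V=V(\Gamma)$ and integer weights $f_v$. Its matrix $B$ has $B_{vv'}=1$ if $\{v,v'\}$ is an edge, $B_{vv}=f_v$, and $0$ otherwise; $B$ is assumed invertible. $\Gamma$ is weakly negative definite if the restriction of $B^{-1}$ to the vertices of degree greater than $2$ is negative definite. $M$ is obtained by surgery on the link in $S^3$ with one $f_v$-framed unknot per vertex, components Hopf linked exactly when adjacent. $b_+,b_-$ are the numbers of positive and negative eigenvalues of $B$, $\sigma=b_+-b_-$, $\mathbf 1=(1,\dots,1)^t\in\mathbb Z^V$. $H_1(M;\mathbb Z)=\mathbb Z^V/B\mathbb Z^V$, of order $|\det B|$. $\mathrm{Spin}(M)=\{s\in(\mathbb Z/2)^V\mid\sum_jB_{ij}s_j\equiv B_{ii}\bmod2\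 \forall i\}$ and $\mathrm{Spin}^c(M)=\{K\in\mathbb Z^V/2B\mathbb Z^V\mid K_i\equiv B_{ii}\bmod2\ \forall i\}$. Each $\mathrm{Spin}^c$ structure is of the form $\mathfrak s=\sigma(b,s)=2b+B\tilde s$ with $b\in H_1(M;\mathbb Z)$, $s\in\mathrm{Spin}(M)$ and $\tilde s\in\mathbb Z^V$ any lift of $s$. For such $\mathfrak s$ let $L_{\mathfrak s}=2b+B(\tilde s-\mathbf 1)+2B\mathbb Z^V\subset\mathbb Z^V$ (independent of choices). Define $F^\pm(x)=\prod_{v\in V}(x_v\pm x_v^{-1})^{2-\deg v}=\sum_{l\in\mathbb Z^V}F^\pm_l\prod_vx_v^{l_v}$, where each factor is expanded as the average of its Laurent expansions at $x_v\to0$ and $x_v\to\infty$. Then, with $\mathbf q$ an indeterminate, $$\widehat Z^{\mathfrak{osp}(1|2)}_{\mathfrak s}(M;\mathbf q)=\mathbf q^{\frac{3\sigma-\mathrm{tr}B}4}\sum_{l\in L_{\mathfrak s}}F^+_l\,\mathbf q^{-\frac14l^tB^{-1}l},\qquad \widehat Z^{\mathfrak{sl}(2)}_{\mathfrak s}(M;\mathbf q)=(-1)^{b_+}\mathbf q^{\frac{3\sigma-\mathrm{tr}B}4}\sum_{l\in L_{\mathfrak s}}F^-_l\,\mathbf q^{-\frac14l^tB^{-1}l},$$ both lying in $\mathbf q^{\Delta}\mathbb Q[[\mathbf q]][\mathbf q^{-1}]$ for some $\Delta\in\mathbb Q$ (depending on the case). *)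

(* Defs.v *)
From HB Require Import structures.
From mathcomp Require Import all_boot all_order all_algebra all_field.
From mathcomp Require Import ring_quotient generic_quotient.
From mathcomp Require Import finmap.
From mathcomp Require Import boolp classical_sets functions cardinality fsbigop reals trigo.
From mathcomp Require Import complex.
From mathcomp Require Import zify ring lra.

Set Implicit Arguments.
Unset Strict Implicit.
Unset Printing Implicit Defensive.

Import Order.TTheory GRing.Theory Num.Theory.
Local Open Scope ring_scope.
Local Open Scope classical_set_scope.
Local Open Scope quotient_scope.

(* The 3-manifold M presented by the graph enters only through the linking
   matrix: H_1(M), Spin(M) and Spin^c(M) are given by their linking-matrix
   models. *)

Record plumbing (n : nat) := Plumbing {
  adj : rel 'I_n;
  framing : 'I_n -> int;
  adj_sym : symmetric adj;
  adj_irr : irreflexive adj;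
  vertices_gt0 : (0 < n)%N;
  adj_connected : forall v w, connect adj v w;
  adj_acyclic : forall p : seq 'I_n, ucycle adj p -> (size p <= 2)%N
}.

Section Plumbing.
Variables (n : nat) (G : plumbing n).

Definition deg (v : 'I_n) : nat := #|adj G v|.

Definition linking : 'M[int]_n :=
  \matrix_(v, w) if v == w then framing G v else (adj G v w)%:R.

Definition linkingF (F : fieldType) : 'M[F]_n := map_mx intr linking.

Definition linking_inv (F : fieldType) : 'M[F]_n := invmx (linkingF F).

Definition weakly_negative_definite (F : realFieldType) : Prop :=
  forall x : 'cV[F]_n, (forall v, (deg v <= 2)%N -> x v 0 = 0) -> x != 0 ->
    (x^T *m linking_inv F *m x) 0 0 < 0.

(* Roots of the characteristic polynomial, listed with multiplicity. *)
Definition eigenvalues : seq algC :=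
  sval (closed_field_poly_normal (char_poly (linkingF algC))).

Definition b_plus : nat := count (fun z => 0 < z) eigenvalues.
Definition b_minus : nat := count (fun z => z < 0) eigenvalues.
Definition signature : int := b_plus%:Z - b_minus%:Z.

End Plumbing.

Definition lattice n (A : 'M[int]_n) : {pred 'cV[int]_n} :=
  fun x => `[< exists y, x = A *m y >].

Lemma lattice_zmod_closed n (A : 'M[int]_n) : zmod_closed (lattice A).
Proof.
split; first by apply/asboolP; exists 0; rewrite mulmx0.
move=> x y /asboolP[a ->] /asboolP[b ->]; apply/asboolP; exists (a - b).
by rewrite mulmxBr.
Qed.

HB.instance Definition _ n (A : 'M[int]_n) :=
  GRing.isZmodClosed.Build 'cV[int]_n (lattice A) (lattice_zmod_closed A).

Section Spin.
Variables (n : nat) (G : plumbing n).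
Local Notation B := (linking G).

Definition H1 := Quotient.quot (lattice B).

(* H_1 is finite when B is invertible, by H1_finite below. *)
Definition H1_order : nat := #|` fset_set [set: H1]|.

Definition is_spin (s : 'cV['F_2]_n) : Prop :=
  forall i, \sum_j (B i j)%:~R * s j 0 = (B i i)%:~R.

Definition is_lift (s : 'cV['F_2]_n) (st : 'cV[int]_n) : Prop :=
  s = map_mx intr st.

Definition ZV_mod_2B := Quotient.quot (lattice (B *+ 2)).

Definition is_spinc (s : ZV_mod_2B) : Prop :=
  exists2 K : 'cV[int]_n,
    s = \pi_ZV_mod_2B K & forall i, (K i 0%R = B i i %[mod 2])%Z.

Record spinc := Spinc { spinc_class :> ZV_mod_2B; _ : is_spinc spinc_class }.

(* The Spin^c structure sigma(b, s) = 2b + B s~, given by a representative b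
   of a class in H_1 and a lift st of a Spin structure. *)
Definition sigma (b st : 'cV[int]_n) : ZV_mod_2B :=
  \pi_ZV_mod_2B (b *+ 2 + B *m st).

(* Union, over all presentations s = sigma(b, s~), of the sets
   2b + B(s~ - 1) + 2B Z^V; these all coincide. *)
Definition Lset (s : spinc) : set 'cV[int]_n :=
  [set l | exists b s0 st m, [/\ is_spin s0, is_lift s0 st,
     spinc_class s = sigma b st &
     l = b *+ 2 + B *m (st - const_mx 1) + (B *+ 2) *m m]].

End Spin.

(* laurent_0 and laurent_oo are the two Laurent expansions of (x + e x^-1)^m,
   e <> 0, written with Newton's binomial series. *)

Definition gbinom (m : int) (k : nat) : rat :=
  (\prod_(i < k) (m - i%:Z))%:~R / k`!%:R.

(* At x -> 0, coefficient of x^p in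
   (e x^-1)^m (1 + e^-1 x^2)^m = \sum_k e^(m-k) gbinom m k x^(2k-m). *)
Definition laurent_0 (e : rat) (m p : int) : rat :=
  if (0 <= p + m) && (2 %| p + m)%Z
  then let k := (absz (p + m))./2 in e ^ (m - k%:Z) * gbinom m k else 0.

(* At x -> oo, coefficient of x^p in
   x^m (1 + e x^-2)^m = \sum_k e^k gbinom m k x^(m-2k). *)
Definition laurent_oo (e : rat) (m p : int) : rat :=
  if (0 <= m - p) && (2 %| m - p)%Z
  then let k := (absz (m - p))./2 in e ^+ k * gbinom m k else 0.

(* Coefficient of \prod_v x_v^(l_v) in F^+ (e = 1) or F^- (e = -1). *)
Definition Fcoef n (G : plumbing n) (e : rat) (l : 'cV[int]_n) : rat :=
  \prod_v ((laurent_0 e (2 - (deg G v)%:Z) (l v 0) +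
            laurent_oo e (2 - (deg G v)%:Z) (l v 0)) / 2).

(* S : qseries represents the formal sum over x of S(x) q^x. *)
Definition qseries (K : Type) := rat -> K.

Section Zhat.
Variables (n : nat) (G : plumbing n) (s : spinc G).
Local Notation B := (linking G).

(* Exponent of the term indexed by l, including the prefactor
   q^((3 signature - tr B) / 4). *)
Definition qexp (l : 'cV[int]_n) : rat :=
  let lQ := map_mx intr l : 'cV[rat]_n in
  (3 * signature G - \tr B)%:~R / 4 -
  4^-1 * (lQ^T *m linking_inv G rat *m lQ) 0 0.

(* \sum_(l \in _) is the sum over the support of the summand, and would be 0 if
   that support were infinite; by theta_finite below it is finite for weakly
   negative definite G. *)
Definition theta (e : rat) : qseries rat :=
  fun x => \sum_(l \in [set l | Lset s l /\ qexp l = x]) Fcoef G e l.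

Definition Zhat_osp : qseries rat := theta 1.

Definition Zhat_sl2 : qseries rat := fun x => (-1) ^+ b_plus G * theta (-1) x.

End Zhat.

Section Substitution.
Variable R : realType.

Definition expi_pi (x : rat) : R[i] :=
  (cos (pi * ratr x) +i* sin (pi * ratr x))%C.

Definition qmap_C (S : qseries rat) : qseries R[i] := fun x => ratr (S x).

(* q |-> -q, with (-q)^x = exp(pi i x) q^x. *)
Definition qsubst_opp (S : qseries R[i]) : qseries R[i] :=
  fun x => expi_pi x * S x.

Definition qscale (c : R[i]) (S : qseries R[i]) : qseries R[i] :=
  fun x => c * S x.

End Substitution.

Lemma H1_finite n (G : plumbing n) :
  linkingF G rat \in unitmx -> finite_set [set: H1 G].
Proof.
rewrite /linkingF unitmxE det_map_mx unitfE intr_eq0 => dB.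
set d := \det (linking G) in dB.
pose f (g : {ffun 'I_n -> 'I_(absz d)}) : H1 G :=
  \pi_(H1 G) (\col_i (g i : nat)%:Z).
apply: (@sub_finite_set _ _ (f @` [set: _])); last first.
  by apply: finite_image; exact: finite_finset.
move=> c _; elim/quotW: c => K.
have d0 : (0 < absz d)%N by rewrite absz_gt0.
have ltd i : (absz (K i ord0 %% d)%Z < absz d)%N.
  have := ltz_mod (K i ord0) dB; have := modz_ge0 (K i ord0) dB; lia.
exists [ffun i => Ordinal (ltd i)] => //.
rewrite /f; apply/eqP; rewrite -Quotient.idealrBE; apply/asboolP.
exists (- \adj (linking G) *m (\col_i (K i ord0 %/ d)%Z)).
rewrite mulmxA mulmxN mul_mx_adj mulNmx mul_scalar_mx; apply/matrixP=> i j.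
rewrite !mxE ffunE /= (ord1 j) gez0_abs ?modz_ge0 //.
by rewrite {2}(divz_eq (K i 0) d); rewrite -/d; ring.
Qed.

Section Laurent.
Variable e : rat.

Lemma gbinom0 m : gbinom m 0 = 1.
Proof. by rewrite /gbinom big_ord0 fact0 divr1. Qed.

Lemma gbinomS (m : int) k : gbinom (m + 1) k.+1 = gbinom m k.+1 + gbinom m k.
Proof.
rewrite /gbinom [in LHS]big_ord_recl [in X in _ = X + _]big_ord_recr /=.
have -> : \prod_(i < k) (m + 1 - (bump 0 i)%:Z) = \prod_(i < k) (m - i%:Z).
  by apply: eq_bigr => i _; rewrite /bump /=; lia.
rewrite factS natrM !rmorphM /= !rmorphB /= rmorphD /=.
have k1 : k.+1%:R != 0 :> rat by rewrite pnatr_eq0.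
have kf : k`!%:R != 0 :> rat by rewrite pnatr_eq0 -lt0n fact_gt0.
by rewrite -[k.+1]addn1 natrD in k1 *; field; rewrite k1 kf.
Qed.

Lemma gbinom_gt (m k : nat) : (m < k)%N -> gbinom m k = 0.
Proof.
by move=> mk; rewrite /gbinom (bigD1 (Ordinal mk)) //= subrr !mul0r.
Qed.

(* The next three facts determine laurent_0 as the family of powers of
   x + e x^-1 in the field of Laurent series in x. *)
Lemma laurent_0_expr0 p : laurent_0 e 0 p = (p == 0)%:R.
Proof.
rewrite /laurent_0 addr0; case: eqP => [->|p0]; first by rewrite gbinom0 mulr1.
case: ifP => // /andP[p_ge0 p2]; rewrite (@gbinom_gt 0) ?mulr0 //; lia.
Qed.

Lemma laurent_0_exprS (m p : int) : e != 0 ->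
  laurent_0 e (m + 1) p = laurent_0 e m (p - 1) + e * laurent_0 e m (p + 1).
Proof.
move=> e_neq0; rewrite /laurent_0; have [c|c] := boolP ((0 <= p + m + 1) && (2 %| p + m + 1)%Z).
  have [k E] : exists k : nat, p = 2 * k%:Z - m - 1.
    by exists (absz (p + m + 1)%R)./2; lia.
  rewrite {p}E in c *; case: k c => [|k] c.
    rewrite ifT 1?[X in _ = X + _]ifF 1?[X in _ * X]ifT; try lia.
    have -> : 2 * 0%N%:Z - m - 1 + (m + 1) = 0 by lia.
    have -> : 2 * 0%N%:Z - m - 1 + 1 + m = 0 by lia.
    rewrite /= !gbinom0 !mulr1 !subr0 add0r.
    by rewrite exprzDr ?unitfE // [e ^ 1]expr1z mulrC.
  rewrite !ifT; try lia.
  have -> : (absz (2 * k.+1%:Z - m - 1 + (m + 1))%R)./2 = k.+1 by lia.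
  have -> : (absz (2 * k.+1%:Z - m - 1 - 1 + m)%R)./2 = k by lia.
  have -> : (absz (2 * k.+1%:Z - m - 1 + 1 + m)%R)./2 = k.+1 by lia.
  have -> : m + 1 - k.+1%:Z = m - k%:Z by lia.
  have -> : m - k%:Z = 1 + (m - k.+1%:Z) by lia.
  by rewrite gbinomS (exprzDr _ 1) ?unitfE // [e ^ 1]expr1z; ring.
by rewrite !ifF ?mulr0 ?addr0 //; lia.
Qed.

Lemma laurent_0_lt m p : p < - m -> laurent_0 e m p = 0.
Proof. by move=> pm; rewrite /laurent_0 ifF //; lia. Qed.

(* Likewise for laurent_oo, in the field of Laurent series in x^-1. *)
Lemma laurent_oo_expr0 p : laurent_oo e 0 p = (p == 0)%:R.
Proof.
rewrite /laurent_oo sub0r; case: eqP => [->|p0]; first by rewrite gbinom0 mulr1.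
case: ifP => // /andP[p_ge0 p2]; rewrite (@gbinom_gt 0) ?mulr0 //; lia.
Qed.

Lemma laurent_oo_exprS (m p : int) :
  laurent_oo e (m + 1) p = laurent_oo e m (p - 1) + e * laurent_oo e m (p + 1).
Proof.
rewrite /laurent_oo; have [c|c] := boolP ((0 <= m + 1 - p) && (2 %| m + 1 - p)%Z).
  have [k E] : exists k : nat, p = m + 1 - 2 * k%:Z.
    by exists (absz (m + 1 - p)%R)./2; lia.
  rewrite {p}E in c *; case: k c => [|k] c.
    rewrite ifT 1?[X in _ = _ + _ * X]ifF 1?[X in _ = X + _]ifT; try lia.
    have -> : m + 1 - (m + 1 - 2 * 0%N%:Z) = 0 by lia.
    have -> : m - (m + 1 - 2 * 0%N%:Z - 1) = 0 by lia.
    by rewrite /= !gbinom0 mulr0 addr0.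
  rewrite !ifT; try lia.
  have -> : (absz (m + 1 - (m + 1 - 2 * k.+1%:Z))%R)./2 = k.+1 by lia.
  have -> : (absz (m - (m + 1 - 2 * k.+1%:Z - 1))%R)./2 = k.+1 by lia.
  have -> : (absz (m - (m + 1 - 2 * k.+1%:Z + 1))%R)./2 = k by lia.
  by rewrite gbinomS exprS; ring.
by rewrite !ifF ?mulr0 ?addr0 //; lia.
Qed.

Lemma laurent_oo_gt m p : m < p -> laurent_oo e m p = 0.
Proof. by move=> pm; rewrite /laurent_oo ifF //; lia. Qed.

Lemma laurent_nat_supp (m : nat) p : (m < absz p)%N ->
  laurent_0 e m p = 0 /\ laurent_oo e m p = 0.
Proof.
move=> mp; rewrite /laurent_0 /laurent_oo.
by split; case: ifP => // c; rewrite gbinom_gt ?mulr0 //; lia.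
Qed.

End Laurent.

Lemma finite_box n (N : nat) :
  finite_set [set l : 'cV[int]_n | forall i, (absz (l i 0%R) <= N)%N].
Proof.
pose f (g : {ffun 'I_n -> 'I_(N + N).+1}) : 'cV[int]_n :=
  \col_i ((g i : nat)%:Z - N%:Z).
apply: (@sub_finite_set _ _ (f @` [set: _])); last first.
  by apply: finite_image; exact: finite_finset.
move=> l /= lN; have lt i : (absz (l i 0%R + N%:Z)%R < (N + N).+1)%N.
  by have := lN i; lia.
exists [ffun i => Ordinal (lt i)] => //.
apply/matrixP => i j; rewrite (ord1 j) !mxE ffunE /=.
by have := lN i; lia.
Qed.

Section QuadraticForm.
Variables (F : archiRealFieldType) (n : nat) (A : 'M[F]_n) (S : pred 'I_n).
Let q (x y : 'cV[F]_n) : F := (x^T *m A *m y) 0 0.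
Let inS (x : 'cV[F]_n) := forall i, ~~ S i -> x i 0 = 0.
Hypothesis A_sym : A^T = A.
Hypothesis A_pos : forall x, inS x -> x != 0 -> 0 < q x x.

Let qC x y : q x y = q y x.
Proof.
rewrite /q; have -> : x^T *m A *m y = (y^T *m A *m x)^T.
  by rewrite !trmx_mul trmxK A_sym mulmxA.
by rewrite mxE.
Qed.
Let qDl x y z : q (x + y) z = q x z + q y z.
Proof. by rewrite /q linearD /= !mulmxDl mxE. Qed.
Let qNl x y : q (- x) y = - q x y.
Proof. by rewrite /q linearN /= !mulNmx mxE. Qed.
Let qDr x y z : q z (x + y) = q z x + q z y.
Proof. by rewrite qC qDl !(qC z). Qed.
Let qNr x y : q y (- x) = - q y x.
Proof. by rewrite qC qNl qC. Qed.
Let qge0 x : inS x -> 0 <= q x x.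
Proof.
move=> xS; have [->|x0] := eqVneq x 0; last exact/ltW/A_pos.
by rewrite /q mulmx0 mxE.
Qed.

Let P : 'M[F]_n := diag_mx (\row_i (S i)%:R).

Let PE (x : 'cV[F]_n) i : (P *m x) i 0 = (S i)%:R * x i 0.
Proof. by rewrite mul_diag_mx !mxE. Qed.

Let Pid x : inS x -> P *m x = x.
Proof.
move=> xS; apply/matrixP => i j; rewrite (ord1 j) PE.
by case: (boolP (S i)) => [_|/xS->]; rewrite ?mul1r ?mulr0.
Qed.

Let PS x : inS (P *m x).
Proof. by move=> i /negbTE iS; rewrite PE iS mul0r. Qed.

Let P_tr : P^T = P. Proof. exact: tr_diag_mx. Qed.

Let dual (b : 'cV[F]_n) :
  exists2 d, inS d & forall x, inS x -> q x d = (x^T *m b) 0 0.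
Proof.
pose M := P *m A *m P + (1%:M - P).
have PP : P *m P = P.
  apply/matrixP => i j; rewrite mul_diag_mx !mxE.
  by case: (S i); rewrite ?mul1r ?mul0r ?mul0rn.
have QM : (1%:M - P) *m M = 1%:M - P.
  have QP : (1%:M - P) *m P = 0 by rewrite mulmxBl mul1mx PP subrr.
  by rewrite mulmxDr !mulmxA QP !mul0mx add0r mulmxBr mulmx1 QP subr0.
have Mu : M \in unitmx.
  rewrite -unitmx_tr -row_free_unit -kermx_eq0; apply/rowV0P => v /sub_kermxP vM.
  pose x := v^T; have Mx : M *m x = 0 by rewrite -[M]trmxK -trmx_mul vM trmx0.
  have Qx : (1%:M - P) *m x = 0 by rewrite -QM -mulmxA Mx mulmx0.
  have Px : P *m x = x.
    by apply/eqP; rewrite eq_sym -subr_eq0 -{1}[x]mul1mx -mulmxBl Qx.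
  have xS : inS x by rewrite -Px; exact: PS.
  have : q x x = 0.
    have PAx : P *m A *m x = 0.
      by move: Mx; rewrite /M mulmxDl Qx addr0 -mulmxA Px.
    have -> : q x x = q (P *m x) x by rewrite Px.
    by rewrite /q trmx_mul P_tr -!mulmxA [P *m _]mulmxA PAx mulmx0 mxE.
  have [x0 _|x0 q0] := eqVneq x 0; first by rewrite -[v]trmxK -/x x0 trmx0.
  by have := A_pos xS x0; rewrite q0 ltxx.
pose d := invmx M *m (P *m b); have Md : M *m d = P *m b by rewrite mulKVmx.
have Qd : (1%:M - P) *m d = 0.
  by rewrite -QM -mulmxA Md mulmxA mulmxBl mul1mx PP subrr mul0mx.
have Pd : P *m d = d.
  by apply/eqP; rewrite eq_sym -subr_eq0 -{1}[d]mul1mx -mulmxBl Qd.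
exists d; first by rewrite -Pd; exact: PS.
move=> x xS; have xP : x^T = x^T *m P by rewrite -{1}(Pid xS) trmx_mul P_tr.
congr (fun_of_matrix _ _ _).
have : P *m A *m d = P *m b.
  by rewrite -Md /M mulmxDl Qd addr0 -!mulmxA Pd.
by rewrite xP -!mulmxA => <-; rewrite mulmxA.
Qed.

(* On the translate of the coordinate subspace of S by a, the sublevel sets of
   A have boundedly many integral points. *)
Lemma sublevel_bounded (a : 'cV[F]_n) (C : F) : exists N : nat,
  forall u : 'cV[F]_n, inS u -> q (a + u) (a + u) <= C ->
    forall i, `|u i 0| <= N%:R.
Proof.
have [d dS dE] := dual (A *m a).
have key i : exists N : nat, forall u : 'cV[F]_n, inS u ->
    q (a + u) (a + u) <= C -> `|u i 0| <= N%:R.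
  have [w wS wE] := dual (delta_mx i 0).
  have wE' x : inS x -> q x w = x i 0.
    by move=> xS; rewrite wE // -colE !mxE.
  exists (Num.bound (`|d i 0| + `|C + q d d - q a a + q w w|)) => u uS uC.
  set y := u + d; have yS : inS y by move=> j jS; rewrite mxE uS // dS // addr0.
  have qy : q y y <= C + q d d - q a a.
    have ua : q u a = q u d by rewrite dE // /q mulmxA.
    move: uC; rewrite /y !qDl !qDr (qC a u) (qC d u) ua; lra.
  have ywS : inS (y - w) by move=> j jS; rewrite !mxE uS // dS // wS // addr0 subr0.
  have ywS' : inS (y + w) by move=> j jS; rewrite !mxE uS // dS // wS // !addr0.
  have := qge0 ywS; have := qge0 ywS'.
  have yi : y i 0 = u i 0 + d i 0 by rewrite mxE.
  clearbody y; rewrite !(qDl, qDr, qNl, qNr) (qC w y) (wE' y) // yi => h1 h2.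
  apply: le_trans (ltW (archi_boundP _)); last by rewrite addr_ge0.
  have := ler_norm (C + q d d - q a a + q w w).
  have := ler_norm (d i 0); have := ler_norm (- d i 0); rewrite normrN => *.
  have := normr_ge0 (C + q d d - q a a + q w w) => *.
  rewrite ler_norml; apply/andP; split; lra.
have [f fE] := choice key.
exists (\sum_i f i)%N => u uS uC i; apply: le_trans (fE i u uS uC) _.
by rewrite ler_nat (bigD1 i) //= leq_addr.
Qed.

End QuadraticForm.

(* For every exponent x0, finitely many terms of the defining sums have
   exponent at most x0. In particular the sums theta s e x are finite, and the
   exponents occurring in theta s e are bounded below. *)
Lemma theta_finite (R : realType) n (G : plumbing n) (e : rat) (x0 : rat) :
  weakly_negative_definite G R ->
  finite_set [set l | Fcoef G e l != 0 /\ qexp G l <= x0].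
Proof.
move=> hG; pose S v := (2 < deg G v)%N.
pose rest (l : 'cV[int]_n) : 'cV[int]_n := \col_v (if S v then 0 else l v 0).
pose A : 'M[R]_n := - linking_inv G R.
have A_sym : A^T = A.
  rewrite /A linearN /= /linking_inv trmx_inv; congr (- invmx _).
  apply/matrixP => v w; rewrite !mxE eq_sym; case: eqP => [->//|_].
  by rewrite adj_sym.
have A_pos (x : 'cV[R]_n) : (forall i, ~~ S i -> x i 0 = 0) -> x != 0 ->
    0 < (x^T *m A *m x) 0 0.
  move=> xS x0'; rewrite /A mulmxN mulNmx mxE oppr_gt0; apply: hG => // v dv.
  by apply: xS; rewrite /S -leqNgt.
pose k : rat := (3 * signature G - \tr (linking G))%:~R.
have qexpE l : let lR := map_mx intr l : 'cV[R]_n in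
    qexp G l <= x0 -> (lR^T *m A *m lR) 0 0 <= ratr (4 * x0 - k).
  move=> lR; set lQ := map_mx intr l : 'cV[rat]_n.
  have -> : lR = map_mx (@ratr R) lQ.
    by apply/matrixP => i j; rewrite /lR /lQ !mxE ratr_int.
  have -> : A = map_mx (@ratr R) (- linking_inv G rat).
    rewrite map_mxN /A /linking_inv map_invmx; congr (- invmx _).
    by rewrite /linkingF -map_mx_comp; apply: eq_map_mx => z /=; rewrite ratr_int.
  move=> qx; rewrite map_trmx -!map_mxM mxE ler_rat mulmxN mulNmx [leLHS]mxE.
  move: qx; rewrite /qexp -/lQ -/k.
  by move: (fun_of_matrix _ _ _) => X; lra.
have fin_rest (a : 'cV[int]_n) :
    finite_set [set l | rest l = a /\ qexp G l <= x0].
  pose aR := map_mx intr a : 'cV[R]_n.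
  have [N hN] := @sublevel_bounded R n A S A_sym A_pos aR (ratr (4 * x0 - k)).
  apply: (@sub_finite_set _ _
    ((fun u => a + u) @` [set u : 'cV[int]_n | forall i, (absz (u i 0%R) <= N)%N])).
    move=> l /= [la lx]; exists (l - a); last by rewrite addrC subrK.
    move=> i; have := hN (map_mx intr (l - a)).
    have -> : aR + map_mx intr (l - a) = map_mx intr l.
      by rewrite -map_mxD addrC subrK.
    have lS j : ~~ S j -> (map_mx intr (l - a) : 'cV[R]_n) j 0 = 0.
      by move=> /negbTE jS; rewrite -la !mxE jS subrr.
    move=> /(_ lS (qexpE _ lx) i); rewrite mxE -intr_norm pmulrn ler_int.
    lia.
  by apply: finite_image; exact: finite_box.
apply: (@sub_finite_set _ _
  (\bigcup_(a in [set a : 'cV[int]_n | forall i, (absz (a i 0%R) <= 2)%N])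
     [set l | rest l = a /\ qexp G l <= x0])).
  move=> l /= [Fl lx]; exists (rest l) => //= i; rewrite mxE.
  case: ifP => // /negbT; rewrite -leqNgt => di.
  rewrite leqNgt; apply/negP => li; case/negP: Fl; apply/eqP.
  rewrite /Fcoef (bigD1 i) //=.
  have -> : 2 - (deg G i)%:Z = (2 - deg G i)%N%:Z by lia.
  have [|-> ->] := @laurent_nat_supp e (2 - deg G i)%N (l i 0); first lia.
  by rewrite addr0 !mul0r.
by apply: bigcup_finite => // ; exact: finite_box.
Qed.

(* Main.v *)
(* The coefficients F^+_l and F^-_l differ by a sign, the (-1)-power of
   [sign_exponent l], so the term of exponent q(l) on the left is
   exp(pi i (q(l) + sign_exponent l)) times the one on the right. On the coset
   L_s = l0 + 2B Z^V the number q(l) + sign_exponent l is constant modulo 2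
   wherever F^-_l is nonzero, because then l_v = deg v mod 2. Since |H_1|
   kills H_1, the number 4 |H_1| q(l0) is an integer, which bounds the order of
   the resulting constant. *)

Require Import Defs.
From mathcomp Require Import all_boot all_order all_algebra.
From mathcomp Require Import reals complex.
From mathcomp Require Import ring_quotient generic_quotient finmap.
From mathcomp Require Import boolp classical_sets cardinality fsbigop trigo.
From mathcomp Require Import zify ring.

Set Implicit Arguments.
Unset Strict Implicit.
Unset Printing Implicit Defensive.
Import GRing.Theory.
Local Open Scope ring_scope.

Lemma ratr_signz (F : numFieldType) (j : int) : ratr ((-1) ^ j) = (-1) ^ j :> F.
Proof. by rewrite rmorphXz ?unitrN1 //= rmorphN1. Qed.

(** * The character x -> exp(pi i x) of the rationals *)

Section Phase.
Variable R : realType.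

Lemma expi_piD (x y : rat) : expi_pi R (x + y) = expi_pi R x * expi_pi R y.
Proof.
rewrite /expi_pi rmorphD /= mulrDr cosD sinD; apply/eqP; rewrite eq_complex /=.
by rewrite eqxx /= addrC eqxx.
Qed.

Lemma expi_pi0 : expi_pi R 0 = 1.
Proof. by rewrite /expi_pi rmorph0 mulr0 cos0 sin0. Qed.

Lemma expi_pi_int (j : int) : expi_pi R j%:~R = (-1) ^ j.
Proof.
have nat_case (k : nat) : expi_pi R k%:R = (-1) ^+ k.
  elim: k => [|k IH]; first by rewrite expi_pi0.
  rewrite -addn1 natrD expi_piD IH exprD expr1; congr (_ * _).
  by rewrite /expi_pi rmorph1 mulr1 cospi sinpi; apply/eqP; rewrite eq_complex /= oppr0 !eqxx.
case: j => k; first exact: nat_case.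
rewrite NegzE mulrNz -exprnN -nat_case; apply: (mulfI (x := expi_pi R k.+1%:R)).
  by rewrite nat_case signr_eq0.
by rewrite -expi_piD subrr expi_pi0 mulfV // nat_case signr_eq0.
Qed.

Lemma expi_piX (x : rat) k : expi_pi R x ^+ k = expi_pi R (k%:R * x).
Proof.
elim: k => [|k IH]; first by rewrite mul0r expi_pi0.
by rewrite exprS IH -expi_piD -natr1 mulrDl mul1r addrC.
Qed.

Lemma expi_pi_even (j : int) : expi_pi R (2 * j%:~R) = 1.
Proof. by rewrite -(intrM _ 2) expi_pi_int -exprz_exp -exprnP sqrrN expr1n exp1rz. Qed.

End Phase.

Lemma mulmxnl (R : comNzRingType) m n p k (A : 'M[R]_(m, n)) (B : 'M[R]_(n, p)) :
  (A *+ k) *m B = (A *m B) *+ k.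
Proof. by rewrite -!scaler_nat scalemxAl. Qed.

Lemma mulmxnr (R : comNzRingType) m n p k (A : 'M[R]_(m, n)) (B : 'M[R]_(n, p)) :
  A *m (B *+ k) = (A *m B) *+ k.
Proof. by rewrite -!scaler_nat scalemxAr. Qed.

(** Off-diagonal terms of a symmetric form come in equal pairs, so modulo 2 only the diagonal
    survives. *)
Lemma quad_form_parity n (A : 'M[int]_n) (m : 'cV[int]_n) : A^T = A ->
  exists d : int, (m^T *m A *m m) 0 0 = \sum_i A i i * m i 0 ^+ 2 + 2 * d.
Proof.
move=> A_sym; pose F i j := m i 0 * A i j * m j 0.
have FC i j : F i j = F j i.
  by rewrite /F -[in LHS]A_sym mxE; ring.
have -> : (m^T *m A *m m) 0 0 = \sum_i \sum_j F i j.
  rewrite mxE exchange_big /=; apply: eq_bigr => i _.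
  by rewrite mxE mulr_suml; apply: eq_bigr => j _; rewrite mxE.
exists (\sum_(i < n) \sum_(j < n | (j < i)%N) F i j).
have splitF (i : 'I_n) : \sum_j F i j =
    F i i + (\sum_(j < n | (j < i)%N) F i j + \sum_(j < n | (i < j)%N) F i j).
  rewrite (bigD1 i) //= (bigID (fun j : 'I_n => (j < i)%N)) /=.
  by congr (_ + (_ + _)); apply: eq_bigl => j; rewrite -val_eqE /=; lia.
under eq_bigr => i _ do rewrite splitF.
rewrite !big_split /=.
have -> : \sum_(i < n) \sum_(j < n | (i < j)%N) F i j =
    \sum_(i < n) \sum_(j < n | (j < i)%N) F i j.
  rewrite (exchange_big_dep predT) //=.
  by apply: eq_bigr => i _; apply: eq_bigr => j _.
rewrite mulrDl mul1r; congr (_ + _); apply: eq_bigr => i _.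
by rewrite /F; ring.
Qed.

(** Replacing x by i x turns x + x^-1 into i (x - x^-1), so the coefficients of x^p in the m-th
    powers differ by i^(m-p). The expansion at infinity acquires the same sign, which therefore
    passes to the average. *)
Lemma laurent_0_sign (m p : int) :
  laurent_0 1 m p = (-1) ^ ((m - p) %/ 2)%Z * laurent_0 (-1) m p.
Proof.
rewrite /laurent_0; case: ifP => [c|_]; last by rewrite mulr0.
rewrite mulrA -exprzDr ?unitrN1 // exp1rz mul1r.
have -> : ((m - p) %/ 2)%Z + (m - ((absz (p + m))./2)%:Z) =
    2 * ((m - p) %/ 2)%Z by lia.
by rewrite -exprz_exp -exprnP sqrrN expr1n exp1rz mul1r.
Qed.

Lemma laurent_oo_sign (m p : int) :
  laurent_oo 1 m p = (-1) ^ ((m - p) %/ 2)%Z * laurent_oo (-1) m p.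
Proof.
rewrite /laurent_oo; case: ifP => [c|_]; last by rewrite mulr0.
have -> : ((m - p) %/ 2)%Z = (absz (m - p))./2 by lia.
by rewrite [RHS]mulrA -exprMn mulrNN mulr1.
Qed.

(** * Signs and exponents along cosets of 2B Z^V, and their denominators *)

Section Plumbing.
Variables (n : nat) (G : plumbing n).
Local Notation B := (linking G).
Local Notation BQ := (linkingF G rat).

Lemma linking_sym : B^T = B.
Proof.
apply/matrixP => v w; rewrite !mxE eq_sym; case: eqP => [->//|_].
by rewrite adj_sym.
Qed.

Lemma linking_col_sum w : \sum_v B v w = B w w + (deg G w)%:Z.
Proof.
rewrite (bigD1 w) //=; congr (_ + _).
rewrite /deg -sum1_card -[RHS]natz natr_sum big_mkcond [RHS]big_mkcond /=.
apply: eq_bigr => v _; rewrite mxE; case: eqP => [->|_] /=.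
  by rewrite -topredE /= adj_irr.
by rewrite -topredE /= adj_sym; case: adj.
Qed.

(** The halving is exact wherever the coefficient at l is nonzero, by [Fcoef_parity]; elsewhere both
    coefficients vanish and the rounding is harmless. *)
Definition sign_exponent (l : 'cV[int]_n) : int :=
  \sum_v ((2 - (deg G v)%:Z - l v 0%R) %/ 2)%Z.

Lemma Fcoef_sign l : Fcoef G 1 l = (-1) ^ sign_exponent l * Fcoef G (-1) l.
Proof.
rewrite /sign_exponent (big_morph (exprz (-1)) (id1 := 1) (op1 := *%R)) //; last first.
  by move=> x y; rewrite exprzDr ?unitrN1.
rewrite -big_split /=; apply: eq_bigr => v _.
by rewrite laurent_0_sign laurent_oo_sign -mulrDr mulrA.
Qed.

(** Both expansions of (x + e x^-1)^m contain only powers x^p with p = m mod 2, and here m = 2 - deg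
    v. *)
Lemma Fcoef_parity e l v : Fcoef G e l != 0 -> (2 %| l v 0%R - (deg G v)%:Z)%Z.
Proof.
apply: contraR => odd_v; rewrite /Fcoef (bigD1 v) //= /laurent_0 /laurent_oo.
by rewrite !ifF ?addr0 ?mul0r //; lia.
Qed.

Lemma sign_exponent_shift l m :
  sign_exponent (l + (B *+ 2) *m m) = sign_exponent l - \sum_v (B *m m) v 0.
Proof.
rewrite /sign_exponent -sumrB; apply: eq_bigr => v _.
have halve (a x z : int) : ((a - (x + z *+ 2)) %/ 2)%Z = ((a - x) %/ 2)%Z - z.
  by rewrite mulr2n; lia.
by rewrite -halve mulmxnl mulr2n !mxE.
Qed.

(** With the shift 2Bm, the two cross terms of the form B^-1 add up to 4 m^t l and the square term
    is 4 m^t B m; the prefactor 1/4 cancels the 4. *)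
Lemma qexp_shift l m : BQ \in unitmx ->
  qexp G (l + (B *+ 2) *m m) =
  qexp G l - ((m^T *m l) 0 0 + (m^T *m B *m m) 0 0)%:~R.
Proof.
move=> hB; rewrite /qexp /linking_inv.
set X := map_mx intr l; set Q : 'cV[rat]_n := map_mx intr m.
have -> : map_mx intr (l + (B *+ 2) *m m) = X + BQ *m (Q *+ 2).
  by rewrite map_mxD map_mxM raddfMn /= -/X -/Q -/BQ mulmxnl mulmxnr.
have BQ_sym : BQ^T = BQ by rewrite /linkingF map_trmx linking_sym.
have -> : ((m^T *m l) 0 0 + (m^T *m B *m m) 0 0)%:~R =
    (Q^T *m X) 0 0 + (Q^T *m BQ *m Q) 0 0.
  by rewrite rmorphD /= /Q /X map_trmx -!map_mxM !mxE.
have XQ : (X^T *m Q) 0 0 = (Q^T *m X) 0 0.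
  have -> : X^T *m Q = (Q^T *m X)^T by rewrite trmx_mul trmxK.
  by rewrite mxE.
rewrite [(X + _)^T]linearD /= trmx_mul BQ_sym mulmxDl. rewrite mulmxK // mulmxDl !mulmxDr.
rewrite -[X^T *m invmx _ *m (_ *m _)]mulmxA mulKmx //.
rewrite linearMn /= !(mulmxnl, mulmxnr) mulmxA.
have entryD (M N : 'M[rat]_1) : (M + N) 0 0 = M 0 0 + N 0 0 by rewrite mxE.
rewrite !mulr2n !entryD XQ.
by move: ((Q^T *m X) 0 0) => a; field.
Qed.

(* The exponent drops by m^t l + m^t B m + 1^t B m, which is even: modulo 2,
   1^t B m = \sum_v (B_vv + deg v) m_v, l_v = deg v, and
   m^t B m = \sum_v B_vv m_v. *)
Lemma phase_shift e l m : BQ \in unitmx -> Fcoef G e l != 0 ->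
  exists d : int, qexp G (l + (B *+ 2) *m m) +
    (sign_exponent (l + (B *+ 2) *m m))%:~R =
    qexp G l + (sign_exponent l)%:~R + 2 * d%:~R.
Proof.
move=> hB Fl; have [d0 quadE] := quad_form_parity m linking_sym.
suff [d dE] : exists d : int, \sum_v m v 0 * l v 0 +
    \sum_v B v v * m v 0 ^+ 2 + \sum_v (B *m m) v 0 = 2 * d.
  (* The drop is 2d + 2 d0, where d0 comes from the off-diagonal part of m^t B m. *)
  exists (- d - d0); rewrite qexp_shift // sign_exponent_shift quadE.
  have -> : (m^T *m l) 0 0 = \sum_v m v 0 * l v 0.
    by rewrite mxE; apply: eq_bigr => v _; rewrite mxE.
  rewrite -[LHS]addrA -[RHS]addrA; congr (_ + _).
  have -> : 2 = 2%:~R :> rat by [].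
  rewrite -intrM -rmorphN -!rmorphD /=; congr (_%:~R).
  by rewrite mulrDr !mulrN -dE; ring.
have -> : \sum_v (B *m m) v 0 = \sum_v (B v v + (deg G v)%:Z) * m v 0.
  under eq_bigr => v _ do rewrite mxE.
  rewrite exchange_big /=; apply: eq_bigr => v _.
  by rewrite -linking_col_sum mulr_suml.
rewrite -!big_split /=.
pose f v := m v 0 * l v 0 + B v v * m v 0 ^+ 2 +
  (B v v + (deg G v)%:Z) * m v 0.
exists (\sum_v (f v %/ 2)%Z).
rewrite mulr_sumr; apply: eq_bigr => v _; rewrite -/(f v) /f.
have /dvdzP[k lE] := Fcoef_parity v Fl.
have -> : l v 0 = (deg G v)%:Z + k * 2 by lia.
(* The framing terms combine to B_vv m_v (m_v + 1), a multiple of a product of consecutive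
   integers. *)
have [j jE] : exists j, m v 0 * (m v 0 + 1) = j * 2.
  have [a mE] : exists a, m v 0 = 2 * a \/ m v 0 = 2 * a + 1.
    by exists (m v 0%R %/ 2)%Z; lia.
  case: mE => ->; first by exists (a * (2 * a + 1)); ring.
  by exists ((2 * a + 1) * (a + 1)); ring.
have -> : m v 0 * ((deg G v)%:Z + k * 2) + B v v * m v 0 ^+ 2 +
  (B v v + (deg G v)%:Z) * m v 0 =
  2 * (m v 0 * ((deg G v)%:Z + k) + B v v * j).
  by transitivity (2 * (m v 0 * ((deg G v)%:Z + k)) + B v v * (m v 0 * (m v 0 + 1)));
    last rewrite jE; ring.
by rewrite mulKz.
Qed.

(** Two presentations of one class differ by some 2By, so all of L_s lies in a single coset of 2B
    Z^V. *)
Lemma Lset_shift (s : spinc G) l l' : Lset s l -> Lset s l' ->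
  exists m, l' = l + (B *+ 2) *m m.
Proof.
move=> [b [s0 [st [m [_ _ sE ->]]]]] [b' [s0' [st' [m' [_ _ sE' ->]]]]].
move: sE'; rewrite sE => /eqP; rewrite eq_sym -Quotient.idealrBE.
move=> /asboolP[y yE]; exists (m' - m + y).
have {}yE : b' *+ 2 + B *m st' = b *+ 2 + B *m st + (B *+ 2) *m y.
  by rewrite -yE addrCA subrr addr0.
rewrite !mulmxDr !mulmxN !addrA yE.
move: (B *+ 2 *m y) (B *+ 2 *m m) (B *+ 2 *m m') (B *m const_mx 1) => a c d u.
by apply/matrixP => i j; rewrite !mxE; ring.
Qed.

(** F^+ vanishes wherever F^- does; this settles the exponents to which no term contributes. *)
Lemma theta_eq0 (s : spinc G) x :
  (forall l, Lset s l -> qexp G l = x -> Fcoef G (-1) l = 0) ->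
  theta s 1 x = 0 /\ theta s (-1) x = 0.
Proof.
move=> F0; split; apply: fsbig1 => l [Ll qx]; last exact: F0.
by rewrite Fcoef_sign F0 ?mulr0.
Qed.

Lemma H1_order_gt0 : BQ \in unitmx -> (0 < H1_order G)%N.
Proof.
move=> hB; rewrite /H1_order cardfs_gt0; apply/fset0Pn.
(* Finiteness matters here: [fset_set] of an infinite set is empty. *)
by exists 0; rewrite in_fset_set ?inE //; exact: H1_finite.
Qed.

(* Translation by the class g of y permutes H_1, so the sum of all elements of
   H_1 is unchanged by adding |H_1| g. *)
Lemma H1_order_exponent (y : 'cV[int]_n) : BQ \in unitmx ->
  exists z, y *+ H1_order G = B *m z.
Proof.
move=> hB; have fin := H1_finite hB.
pose F := fset_set [set: H1 G]; pose g : H1 G := (\pi_(H1 G) y)%qT.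
have translate : \sum_(c <- F) c = \sum_(c <- F) (g + c).
  rewrite -(big_map (fun c => g + c) predT id); apply: perm_big.
  apply: uniq_perm; rewrite ?map_inj_uniq ?fset_uniq //; first exact: addrI.
  move=> c; rewrite in_fset_set // in_setT; symmetry; apply/mapP.
  by exists (c - g); rewrite ?in_fset_set ?in_setT // addrC subrK.
have : g *+ H1_order G = 0.
  apply: (addIr (\sum_(c <- F) c)); rewrite add0r [RHS]translate big_split /=.
  by rewrite big_const_seq count_predT -Monoid.iteropE.
rewrite /g -raddfMn => /eqP.
rewrite -(raddf0 \pi_(H1 G)%qT) -Quotient.idealrBE subr0 => /asboolP[z zE].
by exists z.
Qed.

(** With h = |H_1| and h l = B z, the number h l^t B^-1 l = l^t z is an integer; the factor 4 clears
    the quarters. *)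
Lemma qexp_denominator l : BQ \in unitmx ->
  exists k : int, 4 * (H1_order G)%:R * qexp G l = k%:~R.
Proof.
move=> hB; have [z zE] := H1_order_exponent l hB.
pose h := H1_order G; pose a := 3 * signature G - \tr B.
exists (h%:Z * a - (l^T *m z) 0 0); rewrite /qexp -/a -/h.
set X := map_mx intr l.
have hX : h%:R * (X^T *m linking_inv G rat *m X) 0 0 = ((l^T *m z) 0 0)%:~R.
  have -> : h%:R * (X^T *m linking_inv G rat *m X) 0 0 =
      (X^T *m linking_inv G rat *m (X *+ h)) 0 0.
    by rewrite mulmxnr -scaler_nat [RHS]mxE.
  rewrite /X -raddfMn /= zE map_mxM -mulmxA mulKmx // map_trmx -map_mxM.
  by rewrite [LHS]mxE.
rewrite [RHS]rmorphB [X in _ = X - _]rmorphM /= -hX.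
by move: (fun_of_matrix _ _ _) (a%:~R) => c b; field.
Qed.

End Plumbing.

Theorem theorem3 (R : realType) (n : nat) (G : plumbing n)
    (hB : linkingF G rat \in unitmx)
    (hG : weakly_negative_definite G R) (s : spinc G) :
  exists c : R[i],
    (exists2 k : nat, k.-primitive_root c & (k %| 8 * H1_order G)%N) /\
    qsubst_opp (qmap_C R (Zhat_osp s)) = qscale c (qmap_C R (Zhat_sl2 s)).
Proof.
have ratr0 : ratr 0 = 0 :> R[i] by exact: rmorph0.
have [[l0 [Ll0 Fl0]]|no_l] :=
    pselect (exists l, Lset s l /\ Fcoef G (-1) l != 0); last first.
  (* Without a nonzero coefficient on L_s both series are zero. *)
  exists 1; split.
    have [k k_prim k1] := prim_order_exists (isT : 0 < 1)%N (expr1 (1 : R[i])).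
    by exists k => //; exact: dvdn_trans k1 (dvd1n _).
  apply: funext => x; rewrite /qsubst_opp /qscale /qmap_C /Zhat_osp /Zhat_sl2.
  have [|-> ->] := @theta_eq0 _ _ s x; last by rewrite mulr0 ratr0 mulr0 [RHS]mulr0.
  by move=> l Ll _; apply/eqP/negPn/negP => Fl; apply: no_l; exists l.
pose y := qexp G l0 + (sign_exponent G l0)%:~R.
(* The factor (-1)^(b_+) cancels the sign in the normalisation of the sl(2) series. *)
exists (expi_pi R y * (-1) ^+ b_plus G); split.
  suff /prim_order_exists [|k k_prim k_dvd] :
      (expi_pi R y * (-1) ^+ b_plus G) ^+ (8 * H1_order G) = 1.
  - by rewrite muln_gt0 H1_order_gt0.
  - by exists k.
  (* The sign dies in the even power 8 |H_1|, and 8 |H_1| y is an even integer. *)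
  have [k kE] := qexp_denominator l0 hB.
  rewrite exprMn expi_piX exprAC -signr_odd oddM /= expr0 expr1n mulr1.
  have -> : (8 * H1_order G)%:R * y =
      2 * (k + 4 * (H1_order G)%:Z * sign_exponent G l0)%:~R.
    by rewrite /y natrM [X in _ = _ * X]rmorphD /= -kE !rmorphM /=; ring.
  exact: expi_pi_even.
rewrite /qsubst_opp /qscale /qmap_C /Zhat_osp /Zhat_sl2; apply: funext => x.
rewrite [in RHS]rmorphM rmorphXn rmorphN1 /= [RHS]mulrA.
rewrite -[in RHS](mulrA (expi_pi R y)) -expr2 sqrr_sign mulr1.
have [[l1 [[Ll1 qx] Fl1]]|no_l] :=
    pselect (exists l, (Lset s l /\ qexp G l = x) /\ Fcoef G (-1) l != 0).
  (* At a fixed exponent x the q-parts agree, so [phase_shift] makes the sign exponents congruent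
     modulo 2 and one sign factors out of the sum. *)
  have thetaE : theta s 1 x = (-1) ^ sign_exponent G l1 * theta s (-1) x.
    rewrite /theta mulr_fsumr; apply: eq_fsbigr => l; rewrite inE => -[Ll qlx].
    rewrite Fcoef_sign; congr (_ * _).
    have [m lE] := Lset_shift Ll1 Ll; have [d] := phase_shift m hB Fl1.
    rewrite -lE qx qlx -addrA => /addrI.
    have -> : 2 = 2%:~R :> rat by [].
    rewrite -intrM -rmorphD => /intr_inj ->.
    by rewrite exprzDr ?unitrN1 // -exprz_exp -exprnP sqrrN expr1n exp1rz mulr1.
  rewrite thetaE rmorphM /= [LHS]mulrA; congr (_ * _).
  (* Comparison with l0 gives x plus the sign exponent of l1 equal to y modulo 2, so the constant is
     independent of x. *)
  have [m lE] := Lset_shift Ll0 Ll1; have [d] := phase_shift m hB Fl0.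
  rewrite -lE qx -/y => yE.
  have -> : ratr ((-1) ^ sign_exponent G l1) =
      expi_pi R (sign_exponent G l1)%:~R.
    by rewrite expi_pi_int; exact: ratr_signz.
  by rewrite -expi_piD yE expi_piD expi_pi_even mulr1.
have [|-> ->] := @theta_eq0 _ _ s x; last by rewrite ratr0 [LHS]mulr0 [RHS]mulr0.
by move=> l Ll qx; apply/eqP/negPn/negP => Fl; apply: no_l; exists l.
Qed.
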